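(* Suppose $|a|_p>\alpha=\beta$. Then the $p$-adic dynamical system generated by $f$ has the following properties. 1. (1.1) $SI(x_1)=U_{\alpha^2/|a|_p}(0)$. (1.2) $x_2\in S_{|a|_p}(0)$. 2. The fixed point $x_2$ is attractive and $A(x_2)=\mathbb C_p\setminus\big(V_{\alpha^2/|a|_p}(0)\cup\mathcal P\big)$. 3. If $x\in S_{\alpha^2/|a|_p}(0)$, then one of the following two possibilities holds: (3.1) there exist $k\in\mathbb N$ and $\mu_k<\alpha^2/|a|_p$ such that $f^m(x)\in S_{\mu_k}(0)$ for all $m\ge k$ and $f^m(x)\in S_{\alpha^2/|a|_p}(0)$ for $m\le k-1$; (3.2) the trajectory $\{f^k(x):k\ge1\}$ is a subset of $S_{\alpha^2/|a|_p}(0)$.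
   Context: $p$ is a prime and $\mathbb C_p$ is the field of complex $p$-adic numbers with norm $|\cdot|_p$. Let $a,b,d\in\mathbb C_p$ with $ab\neq0$, $a\ne d$, and $$f(x)=\frac{ax^2+bx}{x^2+dx+b},\qquad x\in\mathbb C_p\setminus\{\hat x_1,\hat x_2\},$$ where $\hat x_1,\hat x_2\in\mathbb C_p$ are the two (possibly equal) roots of $x^2+dx+b$. Put $\alpha=|\hat x_1|_p$, $\beta=|\hat x_2|_p$, labelled so that $\alpha\le\beta$. Standing assumption: $f$ has the two distinct fixed points $x_1=0$ and $x_2=a-d$ (in particular $x_2\notin\{\hat x_1,\hat x_2\}$, i.e. $b+a(a-d)\neq0$). $\mathcal P=\{x\in\mathbb C_p:\exists n\in\mathbb N\cup\{0\},\ f^n(x)\in\{\hat x_1,\hat x_2\}\}$, where $f^n$ is the $n$-th iterate ($f^0=\mathrm{id}$). For $c\in\mathbb C_p$, $r\geq 0$: $U_r(c)=\{x:|x-c|_p<r\}$, $V_r(c)=\{x:|x-c|_p\le r\}$, $S_r(c)=\{x:|x-c|_p=r\}$ (so $S_0(0)=\{0\}$; $\mu_k$ denotes a nonnegative real, possibly $0$). A fixed point $x_0$ is attractive, indifferent, repeller if $|f'(x_0)|_p<1$, $=1$, $>1$ respectively. The basin of attraction is $A(x_0)=\{x: f^n(x)\text{ is defined for all }n\text{ and }f^n(x)\to x_0\}$. A sphere $S$ is invariant if $f$ is defined on $S$ and $f(S)\subset S$. An open ball $U_r(x_0)$ about a fixed point $x_0$ is a Siegel disk if every sphere $S_\rho(x_0)$,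 $0<\rho<r$, is invariant; $SI(x_0)$ is the union of all Siegel disks centred at $x_0$ (the maximal Siegel disk). *)

(* Defs.v *)
From HB Require Import structures.
From mathcomp Require Import all_boot all_order all_algebra.
From mathcomp Require Import all_classical all_reals all_analysis.

Set Implicit Arguments.
Unset Strict Implicit.
Unset Printing Implicit Defensive.

Import Order.TTheory GRing.Theory Num.Theory.
Import numFieldNormedType.Exports.
Local Open Scope classical_set_scope.
Local Open Scope ring_scope.

Section Valued.
Variables (R : realType) (K : fieldType) (N : K -> R).

Definition seq_cvg (u : nat -> K) (l : K) : Prop :=
  N (u n - l) @[n --> \oo] --> (0 : R).

Definition seq_cauchy (u : nat -> K) : Prop :=
  forall e : R, 0 < e -> exists n0 : nat, forall m n : nat,
    (n0 <= m)%N -> (n0 <= n)%N -> N (u m - u n) < e.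

(* The topological closure of the prime field: when K is complete and N
   restricts to the p-adic norm on the rationals, this is a copy of Q_p. *)
Definition rat_closure : set K :=
  [set x | forall e : R, 0 < e -> exists q : rat, N (x - ratr q) < e].

Definition algebraic_over (F : set K) : set K :=
  [set x | exists P : {poly K}, [/\ P != 0, forall i, F P`_i & root P x]].

Definition norm_dense (A : set K) : Prop :=
  forall (x : K) (e : R), 0 < e -> exists2 y, A y & N (x - y) < e.

End Valued.

(* C_p, the completion of an algebraic closure of Q_p, given by the axioms that
   determine it up to isometric isomorphism: a complete algebraically closed
   field whose norm extends the p-adic norm (pnorm_p and the ultrametric
   inequality force this on the rationals, and force characteristic 0), in which
   the elements algebraic over Q_p are dense. *)
Record complexPadicField (R : realType) (p : nat) := ComplexPadicField {
  Cp_sort :> fieldType;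
  pnorm : Cp_sort -> R;
  pnorm_ge0 : forall x, 0 <= pnorm x;
  pnorm_eq0 : forall x, pnorm x = 0 <-> x = 0;
  pnormM : forall x y, pnorm (x * y) = pnorm x * pnorm y;
  pnormD : forall x y, pnorm (x + y) <= Num.max (pnorm x) (pnorm y);
  pnorm_p : pnorm p%:R = p%:R^-1;
  Cp_complete : forall u : nat -> Cp_sort,
    seq_cauchy pnorm u -> exists l, seq_cvg pnorm u l;
  Cp_closed : GRing.closed_field_axiom Cp_sort;
  Cp_dense : norm_dense pnorm (algebraic_over (rat_closure pnorm))
}.

Section Dynamics.
Variables (R : realType) (p : nat) (Cp : complexPadicField R p).
Implicit Types (x c : Cp) (r : R) (A : set Cp).

Definition openBall r c : set Cp := [set x | pnorm (x - c) < r].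
Definition closedBall r c : set Cp := [set x | pnorm (x - c) <= r].
Definition sphere r c : set Cp := [set x | pnorm (x - c) = r].

(* Partial self-maps: g x = None means that g is undefined at x. *)
Variable g : Cp -> option Cp.

Definition piter (n : nat) x : option Cp := iter n (obind g) (Some x).

Definition piter_in (n : nat) x A : Prop :=
  exists2 y, piter n x = Some y & A y.

Definition is_fixed_point x : Prop := g x = Some x.

Definition has_derivative x (l : Cp) : Prop :=
  exists2 y, g x = Some y &
    forall e : R, 0 < e -> exists2 delta : R, 0 < delta &
      forall z, z != x -> pnorm (z - x) < delta ->
        exists2 w, g z = Some w & pnorm ((w - y) / (z - x) - l) < e.

Definition attractive x : Prop :=
  is_fixed_point x /\ exists2 l, has_derivative x l & pnorm l < 1.

Definition basin (x0 : Cp) : set Cp :=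
  [set x | exists2 u : nat -> Cp,
     forall n, piter n x = Some (u n) & seq_cvg (@pnorm R p Cp) u x0].

Definition invariant A : Prop :=
  forall x, A x -> exists2 y, g x = Some y & A y.

Definition siegel_disk r (x0 : Cp) : Prop :=
  [/\ 0 < r, is_fixed_point x0 &
      forall rho : R, 0 < rho -> rho < r -> invariant (sphere rho x0)].

Definition SI (x0 : Cp) : set Cp :=
  [set x | exists2 r, siegel_disk r x0 & openBall r x0 x].

Definition pole_orbits (h1 h2 : Cp) : set Cp :=
  [set x | exists n, piter_in n x [set h1; h2]].

End Dynamics.

Definition ratmap (R : realType) (p : nat) (Cp : complexPadicField R p)
    (a b d : Cp) (x : Cp) : option Cp :=
  if x ^+ 2 + d * x + b == 0 then None
  else Some ((a * x ^+ 2 + b * x) / (x ^+ 2 + d * x + b)).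

(* Main.v *)
Require Import Defs.
From HB Require Import structures.
From mathcomp Require Import all_boot all_order all_algebra.
From mathcomp Require Import all_classical all_reals all_analysis.
From mathcomp Require Import ring.

(** The map is [f x = x (a x + b) / ((x - h1) (x - h2))] with [|b| = alpha ^ 2]
and [|d| <= alpha], so the strong triangle inequality determines [|f x|] from
[|x|]: it equals [|x|] for [|x| < r], [|x| ^ 2 / r] for [r < |x| < alpha], it is
at least [|a|] on [|x| = alpha], and it equals [|a|] for [|x| > alpha]. Hence
every orbit starting outside the closed ball of radius [r] and avoiding the
poles reaches the sphere of radius [|a|]; there
[f x - x2 = (x - x2) (d x + b) / (x ^ 2 + d x + b)] shows that [f] contracts
towards [x2 = a - d] with ratio [alpha / |a|]. The Siegel disk cannot be larger
because [- b / a], of norm [r], is mapped to [0]. *)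

Set Implicit Arguments.
Unset Strict Implicit.
Unset Printing Implicit Defensive.

Import Order.TTheory GRing.Theory Num.Theory.
Import numFieldNormedType.Exports.
Local Open Scope classical_set_scope.
Local Open Scope ring_scope.

(** * Arithmetic of the ultrametric norm *)

Section PadicNorm.
Variables (R : realType) (p : nat) (Cp : complexPadicField R p).
Implicit Types x y : Cp.

Lemma pnorm0 : pnorm (0 : Cp) = 0.
Proof. exact/pnorm_eq0. Qed.

Lemma pnorm_gt0 x : (0 < pnorm x) = (x != 0).
Proof.
rewrite lt_neqAle pnorm_ge0 andbT eq_sym; congr (~~ _).
by apply/eqP/eqP => /pnorm_eq0.
Qed.

Lemma pnorm1 : pnorm (1 : Cp) = 1.
Proof.
have n1 : pnorm (1 : Cp) != 0 by rewrite gt_eqF// pnorm_gt0 oner_neq0.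
by apply: (mulfI n1); rewrite -pnormM !mulr1.
Qed.

(** Squaring removes the sign, and a nonnegative real is determined by its square. *)
Lemma pnormN x : pnorm (- x) = pnorm x.
Proof.
apply/eqP; rewrite -(eqrXn2 (n := 2)) ?pnorm_ge0//.
by rewrite !expr2 -!pnormM mulrNN.
Qed.

Lemma pnormV x : pnorm x^-1 = (pnorm x)^-1.
Proof.
have [->|x0] := eqVneq x 0; first by rewrite invr0 pnorm0 invr0.
have nx : pnorm x != 0 by rewrite gt_eqF// pnorm_gt0.
by apply: (mulfI nx); rewrite -pnormM !divff// pnorm1.
Qed.

Lemma pnorm_div x y : pnorm (x / y) = pnorm x / pnorm y.
Proof. by rewrite pnormM pnormV. Qed.

Lemma pnormD_le x y (s : R) : pnorm x <= s -> pnorm y <= s -> pnorm (x + y) <= s.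
Proof. by move=> xs ys; rewrite (le_trans (pnormD x y))// ge_max xs. Qed.

Lemma pnormB_le x y (s : R) : pnorm x <= s -> pnorm y <= s -> pnorm (x - y) <= s.
Proof. by move=> xs ys; rewrite pnormD_le// pnormN. Qed.

(** Since [y = (x + y) - x], the norm of [y] is at most that of [x + y] or that of [x]; the
    assumption excludes the latter. *)
Lemma pnormD_ltl x y : pnorm x < pnorm y -> pnorm (x + y) = pnorm y.
Proof.
move=> xy; apply/eqP; rewrite eq_le pnormD_le ?(ltW xy)//=.
have := pnormD (x + y) (- x); rewrite addrAC subrr add0r pnormN le_max.
by case/orP => //; rewrite leNgt xy.
Qed.

Lemma pnormD_ltr x y : pnorm y < pnorm x -> pnorm (x + y) = pnorm x.
Proof. by rewrite addrC; exact: pnormD_ltl. Qed.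

Lemma pnormB_ltl x y : pnorm x < pnorm y -> pnorm (x - y) = pnorm y.
Proof. by move=> xy; rewrite pnormD_ltl pnormN. Qed.

Lemma pnormB_ltr x y : pnorm y < pnorm x -> pnorm (x - y) = pnorm x.
Proof. by move=> xy; rewrite pnormD_ltr ?pnormN. Qed.

End PadicNorm.

Lemma piterS (R : realType) (p : nat) (Cp : complexPadicField R p)
    (g : Cp -> option Cp) n x : piter g n.+1 x = obind g (piter g n x).
Proof. by []. Qed.

(** Total version of [ratmap], with value 0 at the poles by the convention on division by 0. Its
    iterates need no options and agree with [piter] as long as no pole is met. *)
Definition ratval (K : fieldType) (a b d x : K) : K :=
  (a * x ^+ 2 + b * x) / (x ^+ 2 + d * x + b).

Section EqualPoleNorms.
Variables (R : realType) (p : nat) (Cp : complexPadicField R p).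
Variables (a b d h1 h2 : Cp) (alpha : R).
Hypothesis denE : forall x : Cp, x ^+ 2 + d * x + b = (x - h1) * (x - h2).
Hypotheses (h1_norm : pnorm h1 = alpha) (h2_norm : pnorm h2 = alpha).
Hypotheses (b_neq0 : b != 0) (alpha_lt : alpha < pnorm a).

Local Notation f := (ratmap a b d).
Local Notation A := (pnorm a).
Local Notation r := (alpha ^+ 2 / pnorm a).
Local Notation F := (ratval a b d).
Local Notation iterF n x := (iter n F x).

(** * Coefficients, poles and the radius [r] *)

Lemma prod_poles : b = h1 * h2.
Proof. by have := denE 0; rewrite expr0n mulr0 !add0r mulrNN. Qed.

Lemma sum_poles : d = - (h1 + h2).
Proof.
have -> : d = (1 ^+ 2 + d * 1 + b) - 1 - b by ring.
by rewrite denE prod_poles; ring.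
Qed.

Lemma pnorm_prod_poles : pnorm b = alpha ^+ 2.
Proof. by rewrite prod_poles pnormM h1_norm h2_norm. Qed.

Lemma pnorm_sum_poles : pnorm d <= alpha.
Proof. by rewrite sum_poles pnormN pnormD_le ?h1_norm ?h2_norm. Qed.

Lemma pole_norm_gt0 : 0 < alpha.
Proof. by rewrite -h1_norm pnorm_gt0; apply: contraNneq b_neq0 => h; rewrite prod_poles h mul0r. Qed.

Lemma leading_norm_gt0 : 0 < A. Proof. exact: lt_trans pole_norm_gt0 alpha_lt. Qed.

#[local] Hint Resolve pole_norm_gt0 leading_norm_gt0 : core.

Lemma radius_gt0 : 0 < r. Proof. by rewrite divr_gt0// exprn_gt0. Qed.

Lemma mulr_radius : A * r = alpha ^+ 2.
Proof. by rewrite mulrC divfK// gt_eqF. Qed.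

Lemma radius_lt : r < alpha.
Proof. by rewrite ltr_pdivrMr// expr2 ltr_pM2l. Qed.

#[local] Hint Resolve radius_gt0 radius_lt pnorm_sum_poles : core.

(** * Norm of the image as a function of the norm of the point *)

Lemma ratmap_pole x : (x == h1) || (x == h2) -> f x = None.
Proof. by rewrite /ratmap denE mulf_eq0 !subr_eq0 => ->. Qed.

Lemma ratmap_regular x : x != h1 -> x != h2 -> f x = Some (F x).
Proof.
by move=> x1 x2; rewrite /ratmap /ratval denE mulf_eq0 !subr_eq0 (negbTE x1) (negbTE x2).
Qed.

Lemma ratmap_off_sphere x : pnorm x != alpha -> f x = Some (F x).
Proof.
move=> xa; apply: ratmap_regular; apply: contraNneq xa => ->.
  by rewrite h1_norm.
by rewrite h2_norm.
Qed.

Lemma pnorm_ratval x : pnorm (F x) =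
  pnorm x * pnorm (a * x + b) / (pnorm (x - h1) * pnorm (x - h2)).
Proof.
rewrite /ratval pnorm_div denE -!pnormM.
by have -> : a * x ^+ 2 + b * x = x * (a * x + b) by ring.
Qed.

Lemma pnorm_ratval_inner x : pnorm x < alpha ->
  pnorm (F x) = pnorm x * pnorm (a * x + b) / alpha ^+ 2.
Proof. by move=> xa; rewrite pnorm_ratval !pnormB_ltl ?h1_norm ?h2_norm. Qed.

Lemma pnorm_ratval_lt x : pnorm x < r -> pnorm (F x) = pnorm x.
Proof.
move=> xr; rewrite pnorm_ratval_inner ?(lt_trans xr)// pnormD_ltl pnorm_prod_poles.
  by rewrite mulfK// gt_eqF// exprn_gt0.
by rewrite pnormM -mulr_radius ltr_pM2l.
Qed.

(** When [x] has norm [r], the terms [a * x] and [b] have equal norm and may cancel, so only an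
    inequality survives. *)
Lemma pnorm_ratval_le x : pnorm x <= r -> pnorm (F x) <= r.
Proof.
move=> xr; rewrite pnorm_ratval_inner ?(le_lt_trans xr)//.
apply: (le_trans _ xr); rewrite ler_pdivrMr ?exprn_gt0//.
rewrite ler_wpM2l ?pnorm_ge0// pnormD_le ?pnorm_prod_poles// pnormM -mulr_radius.
by rewrite ler_pM2l.
Qed.

Lemma pnorm_ratval_between x : r < pnorm x -> pnorm x < alpha ->
  pnorm (F x) = pnorm x ^+ 2 / r.
Proof.
move=> rx xa; rewrite pnorm_ratval_inner// pnormD_ltr pnormM; last first.
  by rewrite pnorm_prod_poles -mulr_radius ltr_pM2l.
by field; rewrite !gt_eqF.
Qed.

(** Here [a * x] dominates [b], so the numerator has norm [A * alpha ^ 2], while each factor of the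
    denominator has norm at most [alpha]. *)
Lemma pnorm_ratval_mid x : pnorm x = alpha -> x != h1 -> x != h2 -> A <= pnorm (F x).
Proof.
move=> xa x1 x2; rewrite pnorm_ratval (pnormD_ltr (x := a * x)) pnormM ?pnorm_prod_poles xa; last first.
  by rewrite expr2 ltr_pM2r.
rewrite ler_pdivlMr; last by rewrite mulr_gt0// pnorm_gt0 subr_eq0.
rewrite [leRHS]mulrCA ler_pM2l// ler_pM ?pnorm_ge0// pnormB_le//.
all: by rewrite ?xa ?h1_norm ?h2_norm.
Qed.

Lemma pnorm_ratval_outer x : alpha < pnorm x -> pnorm (F x) = A.
Proof.
move=> ax; have x0 : 0 < pnorm x by exact: lt_trans pole_norm_gt0 ax.
rewrite pnorm_ratval (pnormD_ltr (x := a * x)) pnormM ?pnorm_prod_poles; last first.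
  by rewrite expr2 ltr_pM ?ltW.
rewrite !pnormB_ltr ?h1_norm ?h2_norm//.
by field; rewrite gt_eqF.
Qed.

(** * Contraction towards the nonzero fixed point *)

Lemma pnorm_den_outer x : alpha < pnorm x -> pnorm (x ^+ 2 + d * x + b) = pnorm x ^+ 2.
Proof.
by move=> ax; rewrite denE pnormM !pnormB_ltr ?h1_norm ?h2_norm.
Qed.

Lemma den_outer_neq0 x : alpha < pnorm x -> x ^+ 2 + d * x + b != 0.
Proof.
move=> ax; rewrite -pnorm_gt0 pnorm_den_outer// exprn_gt0//; exact: lt_trans pole_norm_gt0 ax.
Qed.

Lemma pnorm_fixed_point : pnorm (a - d) = A.
Proof. by rewrite pnormB_ltr// (le_lt_trans pnorm_sum_poles). Qed.

Lemma ratval_sub_fixed x : alpha < pnorm x ->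
  F x - (a - d) = (x - (a - d)) * ((d * x + b) / (x ^+ 2 + d * x + b)).
Proof. by move=> /den_outer_neq0 D0; rewrite /ratval; field. Qed.

Lemma pnorm_multiplier_le x : alpha < pnorm x ->
  pnorm ((d * x + b) / (x ^+ 2 + d * x + b)) <= alpha / pnorm x.
Proof.
move=> ax; have x0 : 0 < pnorm x by exact: lt_trans pole_norm_gt0 ax.
rewrite pnorm_div pnorm_den_outer// ler_pdivrMr ?exprn_gt0//.
have -> : alpha / pnorm x * pnorm x ^+ 2 = alpha * pnorm x by field; rewrite gt_eqF.
rewrite pnormD_le ?pnorm_prod_poles ?pnormM ?ler_wpM2r ?pnorm_ge0//.
by rewrite expr2 ler_pM2l// ltW.
Qed.

Lemma ratval_contracts x : pnorm x = A ->
  pnorm (F x - (a - d)) <= alpha / A * pnorm (x - (a - d)).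
Proof.
move=> xA; have ax : alpha < pnorm x by rewrite xA.
by rewrite ratval_sub_fixed// pnormM mulrC ler_wpM2r ?pnorm_ge0// -xA pnorm_multiplier_le.
Qed.

(** By [ratval_sub_fixed] the difference quotient at [z] is the multiplier evaluated at [z], so the
    derivative is its value at the fixed point. *)
Lemma ratmap_attractive : is_fixed_point f (a - d) -> attractive f (a - d).
Proof.
set y := a - d => fy; split => //.
have yA : pnorm y = A := pnorm_fixed_point.
have ay : alpha < pnorm y by rewrite yA.
exists ((d * y + b) / (y ^+ 2 + d * y + b)); last first.
  by apply: le_lt_trans (pnorm_multiplier_le ay) _; rewrite yA ltr_pdivrMr// mul1r.
(* The bound [A] keeps [z] on the sphere of radius [A], away from the poles. There the multipliers
   at [z] and [y] differ by at most [pnorm (z - y) / A], whence [e * A]. *)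
exists y => // e e0; exists (Num.min A (e * A)); first by rewrite lt_min leading_norm_gt0 mulr_gt0.
move=> z zy; rewrite lt_min => /andP[zyA zye].
have zA : pnorm z = A by rewrite -(subrK y z) pnormD_ltl yA.
have az : alpha < pnorm z by rewrite zA.
exists (F z); first by apply: ratmap_off_sphere; rewrite gt_eqF.
have Dy := den_outer_neq0 ay; have Dz := den_outer_neq0 az.
rewrite ratval_sub_fixed// -/y mulrAC divff ?subr_eq0// mul1r.
have -> : (d * z + b) / (z ^+ 2 + d * z + b) - (d * y + b) / (y ^+ 2 + d * y + b) =
    - ((z - y) * (d * z * y + b * (y + z))) /
      ((z ^+ 2 + d * z + b) * (y ^+ 2 + d * y + b)) by field; rewrite Dy Dz.
rewrite pnorm_div pnormN !pnormM !pnorm_den_outer// yA zA.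
rewrite ltr_pdivrMr ?mulr_gt0 ?exprn_gt0//.
have t : pnorm (d * z * y + b * (y + z)) <= A ^+ 3.
  rewrite pnormD_le// !pnormM ?zA ?yA ?pnorm_prod_poles.
    by rewrite -mulrA exprS -expr2 ler_wpM2r ?exprn_ge0// ?ltW// (le_lt_trans pnorm_sum_poles).
  rewrite (exprSr _ 2); apply: ler_pM; [exact: sqr_ge0|exact: pnorm_ge0| |].
    by rewrite ler_sqr ?nnegrE ?ltW.
  by rewrite pnormD_le ?yA ?zA.
apply: le_lt_trans (ler_wpM2l (pnorm_ge0 _) t) _.
have -> : e * (A ^+ 2 * A ^+ 2) = e * A * A ^+ 3 by ring.
by rewrite ltr_pM2r// exprn_gt0.
Qed.

(** * The maximal Siegel disk *)

Lemma sphere0P (s : R) x : sphere s (0 : Cp) x <-> pnorm x = s.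
Proof. by rewrite /sphere /= subr0. Qed.

Lemma ratmap_siegel : is_fixed_point f 0 -> SI f 0 = openBall r 0.
Proof.
move=> f0; apply/seteqP; split => x /=; rewrite /openBall /= subr0.
  move=> [s [s0 _ inv]]; rewrite /openBall /= subr0 => xs.
  apply: lt_le_trans xs _; rewrite leNgt; apply/negP => rs.
  have wr : pnorm (- b / a) = r by rewrite pnorm_div pnormN pnorm_prod_poles.
  have /inv[||y] := (sphere0P _ _).2 wr => //.
  rewrite ratmap_off_sphere ?wr ?lt_eqF// => -[<-] /sphere0P.
  have a0 : a != 0 by rewrite -pnorm_gt0.
  have -> : F (- b / a) = 0.
    rewrite /ratval; set D := (X in _ / X).
    have -> : a * (- b / a) ^+ 2 + b * (- b / a) = 0 by field.
    by rewrite mul0r.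
  by rewrite pnorm0 => /esym/eqP; rewrite gt_eqF.
move=> xr; exists r; last by rewrite /openBall /= subr0.
split => // rho rho0 rhor z /sphere0P zrho.
have zr : pnorm z < r by rewrite zrho.
exists (F z); last by apply/sphere0P; rewrite pnorm_ratval_lt.
by rewrite ratmap_off_sphere// lt_eqF// (lt_trans zr).
Qed.

(** * Orbits: the basin of attraction and the critical sphere *)

Lemma piter_ratval n x :
  (forall m, (m < n)%N -> iterF m x != h1 /\ iterF m x != h2) ->
  piter f n x = Some (iterF n x).
Proof.
elim: n => [//|n IH] H; rewrite piterS IH => [|m mn]; last exact: H (ltnW mn).
by have [? ?] := H n (ltnSn n); rewrite /= ratmap_regular.
Qed.

Lemma radius_not_pole x : pnorm x <= r -> x != h1 /\ x != h2.
Proof.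
move=> xr; have xa := le_lt_trans xr radius_lt.
split; apply: contraTneq xa => ->; by rewrite ?h1_norm ?h2_norm ltxx.
Qed.

Lemma iter_ratval_small x n : pnorm x <= r -> pnorm (iterF n x) <= r.
Proof. by move=> xr; elim: n => //= n; exact: pnorm_ratval_le. Qed.

Lemma piter_small x n : pnorm x <= r -> piter f n x = Some (iterF n x).
Proof.
by move=> xr; apply: piter_ratval => m _; apply/radius_not_pole/iter_ratval_small.
Qed.

Lemma iter_ratval_outer x : (forall m, iterF m x != h1 /\ iterF m x != h2) ->
  r < pnorm x -> exists n, forall m, pnorm (iterF (n + m) x) = A.
Proof.
move=> reg rx.
have stay n : pnorm (iterF n x) = A -> forall m, pnorm (iterF (n + m) x) = A.
  move=> nA; elim=> [|m IH]; first by rewrite addn0.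
  by rewrite addnS /= pnorm_ratval_outer// IH.
(* Reaching norm [alpha] once is enough: from norm exactly [alpha] the next iterate has norm at
   least [A], and from any larger norm the next one has norm [A]. *)
suff [n an] : exists n, alpha <= pnorm (iterF n x).
  have [n' an'] : exists n, alpha < pnorm (iterF n x).
    move: an; rewrite le_eqVlt => /orP[/eqP an|]; last by exists n.
    exists n.+1; have [? ?] := reg n.
    by apply: lt_le_trans alpha_lt _; exact: pnorm_ratval_mid.
  by exists n'.+1; apply: stay; exact: pnorm_ratval_outer.
apply: contrapT => /forallNP noexit.
have lta n : pnorm (iterF n x) < alpha by rewrite ltNge; apply/negP.
(* An orbit that never exits has its norm squared and divided by [r] at each step. The true growth
   is [r * q ^+ (2 ^ n)]; the geometric lower bound [r * q ^+ n.+1] suffices. *)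
pose q := pnorm x / r.
have q1 : 1 < q by rewrite ltr_pdivlMr// mul1r.
have q0 : 0 < q by exact: lt_trans ltr01 q1.
have rq_ge0 n : 0 <= r * q ^+ n by rewrite mulr_ge0 ?exprn_ge0 ?(ltW q0) ?(ltW radius_gt0).
have grow n : r * q ^+ n.+1 <= pnorm (iterF n x).
  elim: n => [|n IH]; first by rewrite expr1 /q mulrC divfK// gt_eqF.
  have rn : r < pnorm (iterF n x).
    by apply: lt_le_trans IH; rewrite ltr_pMr// exprn_egt1.
  rewrite /= pnorm_ratval_between// ler_pdivlMr// [leRHS]expr2.
  apply: le_trans (ler_pM (rq_ge0 _) (rq_ge0 _) IH IH).
  have -> : r * q ^+ n.+2 * r = r * q * (r * q ^+ n.+1).
    by rewrite (exprS q n.+1); ring.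
  apply: ler_wpM2r => //; rewrite ler_pM2l// (exprS q n).
  by rewrite ler_peMr ?exprn_ege1 ?(ltW q1) ?(ltW q0).
have qV1 : `|q^-1| < 1 by rewrite ger0_norm ?invr_ge0 ?(ltW q0)// invf_lt1.
(* Choosing [n] with [q ^- n.+1 < r / alpha] makes the lower bound exceed [alpha], a
   contradiction. *)
have /cvgrPdist_lt/(_ (r / alpha)) := cvg_expr qV1.
move=> /(_ (divr_gt0 radius_gt0 pole_norm_gt0))[n _ /(_ n.+1 (leqnSn n))] /=.
rewrite sub0r normrN exprVn ger0_norm ?invr_ge0 ?exprn_ge0 ?(ltW q0)//.
have qn : 0 < q ^+ n.+1 by rewrite exprn_gt0.
rewrite ltr_pdivlMr// mulrC ltr_pdivrMr// => H.
by have := lt_trans (le_lt_trans (grow n) (lta n)) H; rewrite ltxx.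
Qed.

Lemma ratmap_basin :
  basin f (a - d) = ~` (closedBall r 0 `|` pole_orbits f h1 h2).
Proof.
apply/seteqP; split => x /=; rewrite /closedBall /= subr0.
  move=> [u uE ucvg] [xr|[n [y yE]]]; last first.
    (* An orbit at a pole at time [n] is undefined at time [n.+1]. *)
    move=> /= yh; have := uE n.+1; rewrite piterS yE /= ratmap_pole//.
    by case: yh => ->; rewrite eqxx ?orbT.
  (* An orbit in the closed ball stays there, hence at distance exactly [A] from [a - d];
     convergence would bring it closer than [A]. *)
  have [n _ /(_ n (leqnn n))] := (cvgrPdist_lt _ _).1 ucvg _ leading_norm_gt0.
  rewrite /= sub0r normrN ger0_norm ?pnorm_ge0// => uA.
  have := uE n; rewrite piter_small// => -[un].
  have : pnorm (u n) < A.
    by rewrite -un (le_lt_trans (iter_ratval_small n xr))// (lt_trans radius_lt).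
  rewrite -pnorm_fixed_point => /pnormB_ltl uA'.
  by move: uA; rewrite uA' pnorm_fixed_point ltxx.
move=> /not_orP[/negP]; rewrite -ltNge => rx npole.
have iterE n : piter f n x = Some (iterF n x).
  elim: n => [//|n IH]; rewrite piterS IH /=.
  by apply: ratmap_regular; apply: contra_notN npole => /eqP e; exists n, (iterF n x) => //=; tauto.
have reg m : iterF m x != h1 /\ iterF m x != h2.
  by split; apply: contra_notN npole => /eqP e; exists m, (iterF m x) => //=; tauto.
exists (fun n => iterF n x) => //.
have [n nA] := iter_ratval_outer reg rx.
pose q := alpha / A.
have q0 : 0 <= q by rewrite divr_ge0 ?ltW.
have q1 : `|q| < 1 by rewrite ger0_norm// ltr_pdivrMr// mul1r.
(* The contraction estimate is available only once the orbit is on the sphere of radius [A], so the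
   first [n] terms are dropped. *)
rewrite /seq_cvg -(cvg_shiftn n).
apply: (@squeeze_cvgr _ _ _ _ (fun=> 0) (fun m => pnorm (iterF n x - (a - d)) * q ^+ m)).
- apply: nearW => m; rewrite pnorm_ge0/= addnC.
  elim: m => [|m IH]; first by rewrite addn0 expr0 mulr1.
  rewrite addnS /=; apply: le_trans (ratval_contracts (nA m)) _.
  by rewrite exprS mulrCA ler_wpM2l.
- exact: cvg_cst.
- rewrite -[X in _ --> X](mulr0 (pnorm (iterF n x - (a - d)))).
  by apply: cvgM; [exact: cvg_cst|exact: cvg_expr].
Qed.

(** An orbit can leave the sphere only inwards, and below [r] the map preserves the norm. So [k] is
    the first exit time and [mu] the norm at that time. *)
Lemma ratmap_critical_sphere x : sphere r 0 x ->
  (exists (k : nat) (mu : R),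
     [/\ (1 <= k)%N, 0 <= mu, mu < r,
         forall m : nat, (k <= m)%N -> piter_in f m x (sphere mu 0) &
         forall m : nat, (m <= k - 1)%N -> piter_in f m x (sphere r 0)])
  \/ (forall k : nat, (1 <= k)%N -> piter_in f k x (sphere r 0)).
Proof.
move=> /sphere0P xr; have xr' : pnorm x <= r by rewrite xr.
have in_sphere m s : pnorm (iterF m x) = s -> piter_in f m x (sphere s 0).
  by move=> e; exists (iterF m x); [exact: piter_small|exact/sphere0P].
have [ex|nex] := pselect (exists m, pnorm (iterF m x) != r); last first.
  right=> k _; apply: in_sphere; apply/eqP; apply: contra_notT nex => e.
  by exists k.
left; case: (ex_minnP ex) => k kr kmin; exists k, (pnorm (iterF k x)).
have kr' : pnorm (iterF k x) < r by rewrite lt_neqAle kr iter_ratval_small.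
have k1 : (1 <= k)%N by case: k kr {kmin kr'} => //; rewrite /= xr eqxx.
split => //; first exact: pnorm_ge0.
  move=> m km; apply: in_sphere; rewrite -(subnKC km).
  elim: (m - k)%N => [|j IH]; first by rewrite addn0.
  by rewrite addnS /= pnorm_ratval_lt IH.
(* Minimality of [k] gives the sphere for [m < k]; this is [m <= k - 1] because [k] is positive. *)
move=> m mk; apply: in_sphere; apply/eqP; apply: contraTT mk => /kmin km.
by rewrite -ltnNge subn1 prednK.
Qed.

End EqualPoleNorms.

Theorem theorem3 (R : realType) (p : nat) (hp : prime p)
    (Cp : complexPadicField R p) (a b d h1 h2 : Cp) (alpha beta : R)
    (hab : a * b != 0) (had : a != d)
    (hroots : 'X^2 + d *: 'X + b%:P = ('X - h1%:P) * ('X - h2%:P))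
    (halpha : alpha = pnorm h1) (hbeta : beta = pnorm h2)
    (hfix1 : is_fixed_point (ratmap a b d) 0)
    (hfix2 : is_fixed_point (ratmap a b d) (a - d))
    (halphabeta : alpha = beta) (ha : alpha < pnorm a) :
  let f := ratmap a b d in
  let x1 : Cp := 0 in
  let x2 : Cp := a - d in
  let r : R := alpha ^+ 2 / pnorm a in
  [/\ SI f x1 = openBall r 0 /\ sphere (pnorm a) 0 x2,
      attractive f x2 /\
        basin f x2 = ~` (closedBall r 0 `|` pole_orbits f h1 h2) &
      forall x : Cp, sphere r 0 x ->
        (exists (k : nat) (mu : R),
           [/\ (1 <= k)%N, 0 <= mu, mu < r,
               forall m : nat, (k <= m)%N -> piter_in f m x (sphere mu 0) &
               forall m : nat, (m <= k - 1)%N -> piter_in f m x (sphere r 0)])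
        \/ (forall k : nat, (1 <= k)%N -> piter_in f k x (sphere r 0))].
Proof.
have b0 : b != 0 by apply: contraNneq hab => ->; rewrite mulr0.
have n1 : pnorm h1 = alpha by rewrite halpha.
have n2 : pnorm h2 = alpha by rewrite halphabeta.
(* The factorisation of polynomials is evaluated at [x]. *)
have denE (x : Cp) : x ^+ 2 + d * x + b = (x - h1) * (x - h2).
  by have := congr1 (fun P => P.[x]) hroots; rewrite !hornerE.
move=> f x1 x2 r; split.
- split; first exact: (ratmap_siegel denE).
  by rewrite /sphere /= subr0; exact: (pnorm_fixed_point denE n1 n2).
- split; first exact: (ratmap_attractive denE n1 n2).
  exact: (ratmap_basin denE n1 n2).
- exact: (ratmap_critical_sphere denE n1 n2).
Qed.
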